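(* Let $(C,T)$ be a minimal Cantor system (with $T$ not assumed invertible). Then there exists an embedding $\pi\colon C\to\mathbb{R}$ such that the map $f\colon \pi(C)\to\pi(C)$ given by $f=\pi\circ T\circ\pi^{-1}$ has derivative $0$ everywhere, i.e. for every $x\in\pi(C)$, $$\lim_{\substack{y\to x\\ y\in \pi(C)\setminus\{x\}}}\frac{f(y)-f(x)}{y-x}=0 .$$
   Context: A Cantor set is a (nonempty) $0$-dimensional compact metric space without isolated points. A Cantor system is a pair $(C,T)$ where $C$ is a Cantor set and $T\colon C\to C$ is a continuous map (invertible or noninvertible). A system is minimal if all of its (forward) orbits $\{T^n(x): n\ge 0\}$ are dense. An embedding is a homeomorphism onto its image. The derivative of a map defined on a subset $P\subset\mathbb{R}$ without isolated points is the limit of difference quotients taken within $P$. *)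

(* Defs.v *)
From HB Require Import structures.
From mathcomp Require Import all_boot all_order all_algebra.
From mathcomp Require Import all_classical all_reals.
From mathcomp Require Import topology normedtype cantor.

Set Implicit Arguments.
Unset Strict Implicit.
Unset Printing Implicit Defensive.

Import Order.TTheory GRing.Theory Num.Theory.
Import numFieldNormedType.Exports.

Local Open Scope classical_set_scope.
Local Open Scope ring_scope.

(* [cantor_like] (perfect, compact, Hausdorff, zero-dimensional) does not
   exclude the empty space, hence the first conjunct.  [zero_dimensional]
   separates distinct points by clopen sets; on compact spaces this amounts to
   the existence of a clopen base. *)
Definition cantor_set (C : topologicalType) : Prop :=
  [set: C] !=set0 /\ cantor_like C.

Definition cantor_system (C : topologicalType) (T : C -> C) : Prop :=
  cantor_set C /\ continuous T.

Definition forward_orbit (C : Type) (T : C -> C) (x : C) : set C :=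
  range (fun n : nat => iter n T x).

Definition minimal (C : topologicalType) (T : C -> C) : Prop :=
  forall x : C, dense (forward_orbit T x).

(* [p] is a homeomorphism onto [range p], whose inverse is the restriction of
   [q] to [range p].  The values of [q] outside [range p] are irrelevant:
   the continuity of [q] is for the subspace topology of [range p]. *)
Definition embedding_with_inverse (X Y : topologicalType)
    (p : X -> Y) (q : Y -> X) : Prop :=
  [/\ continuous p, cancel p q & {within range p, continuous q}].

(* Here [y] tends to [x] within [P `\ x]; only the values of [f] on [P] matter
   when [x] is in [P].  As usual, this determines [l] only if [x] is not an
   isolated point of [P]. *)
Definition has_derivative_within (R : realType)
    (P : set R) (f : R -> R) (x l : R) : Prop :=
  (f y - f x) / (y - x) @[y --> within P x^'] --> l.

(* Main.v *)
Require Import Defs.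
From HB Require Import structures.
From mathcomp Require Import all_boot all_order all_algebra.
From mathcomp Require Import all_classical all_reals.
From mathcomp Require Import topology normedtype cantor.
From mathcomp Require Import interval_inference sequences.
From mathcomp Require Import ring lra.
Import Order.TTheory GRing.Theory Num.Theory.
Import numFieldNormedType.Exports.
Local Open Scope classical_set_scope.
Local Open Scope ring_scope.
Set Implicit Arguments.
Unset Strict Implicit.
Unset Printing Implicit Defensive.

(** The idea is to give [C] a nested sequence of finite clopen partitions
    [P_n] such that [T] maps cells into cells outside a small clopen set
    [U_n], and to choose the sizes of the cells so that they shrink along
    the orbits as long as these stay outside [U_n].

    Given a clopen [U_n], let [r_n] be the hitting time of [U_n]; minimality
    makes it finite and compactness makes it bounded.  Two points are in the
    same cell of [P_n] if they have the same [r_n] and visit the same cells of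
    [P_(n-1)] (and of an auxiliary fine partition) up to that time.  Then [T]
    maps a cell of height [r_n > 0] into a cell of height [r_n - 1]
    ([itinerary_step], [hitting_time_step]): outside [U_n] there is no
    cycle of cells, so nothing prevents the size of a cell from being a very
    rapidly increasing function of its height.  Only at the points of [U_n]
    does [T] fail to be contracting at that scale; but the sets [U_n] can be
    chosen to converge to a point that belongs to none of them, and then every
    point of [C] is in finitely many of them ([vanishing_clopen]).

    The embedding is a sum of digits, the number of the cell of level [n+1]
    being multiplied by a width that depends on [n] and on the height.  If [x]
    and [y] are first separated between the levels [n] and [n+1], then their
    distance in the line is comparable with the width of their common cell of
    level [n] ([position_dist_ge]), whereas the images, which are still in one
    cell of level [n], are at a distance of the order of a much smaller width
    ([position_dist_le]); the quotient is at most [2 / (n+1)]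
    ([position_contract]), and [n] tends to infinity when [y] tends to
    [x]. *)

(** * Locally constant functions *)

(** A clopen partition is represented by a locally constant labelling of its
    cells, with values in any type. *)
Definition locally_constant {X : topologicalType} {A : Type} (f : X -> A) :=
  forall x, \forall y \near x, f y = f x.

Definition refines {X A B : Type} (f : X -> A) (g : X -> B) :=
  forall x y, f x = f y -> g x = g y.

Section locally_constant.
Context {X : topologicalType}.
Implicit Types (A B : Type) (T : X -> X).

Lemma locally_constant_refines A B (f : X -> A) (g : X -> B) :
  refines f g -> locally_constant f -> locally_constant g.
Proof. by move=> fg lf x; apply: filterS (lf x) => y /fg. Qed.

Lemma locally_constant_pair A B (f : X -> A) (g : X -> B) :
  locally_constant f -> locally_constant g ->
  locally_constant (fun x => (f x, g x)).
Proof. by move=> lf lg x; apply: filterS2 (lf x) (lg x) => y -> ->. Qed.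

Lemma locally_constant_precomp A T (f : X -> A) :
  continuous T -> locally_constant f -> locally_constant (f \o T).
Proof. by move=> cT lf x; exact: cT (lf (T x)). Qed.

Lemma locally_constant_clopen (D : set X) :
  clopen D -> locally_constant (fun x => `[< D x >]).
Proof.
move=> [oD cD] x; have [Dx|nDx] := pselect (D x).
  apply: filterS (open_nbhs_nbhs (conj oD Dx)) => y Dy.
  by rewrite !asboolT.
have oC : open (~` D) by exact: closed_openC.
apply: filterS (open_nbhs_nbhs (conj oC nDx)) => y nDy.
by rewrite !asboolF.
Qed.

Lemma open_locally_constant_fiber (u : X -> bool) :
  locally_constant u -> open [set x | u x].
Proof.
move=> lu; rewrite openE => x ux.
by apply: filterS (lu x) => y yx; rewrite /= yx.
Qed.

(** By compactness: near each point the bounds of [f] are eventually valid. *)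
Lemma locally_constant_bounded (f : X -> nat) :
  compact [set: X] -> locally_constant f -> exists N, forall x, (f x <= N)%N.
Proof.
move=> /compact_near_coveringP cX lf.
have [x _|N _ H] := cX _ \oo (fun n x => (f x <= n)%N) _.
  near=> x' n => /=.
  have -> : f x' = f x by near: x'; exact: lf.
  by near: n; exact: nbhs_infty_ge.
by exists N => x; apply: (H N) => //=.
Unshelve. all: by end_near. Qed.

End locally_constant.

(** * Itineraries up to a hitting time *)

Section itinerary.
Context {X : topologicalType} (T : X -> X).

Definition itinerary {A : Type} (r : X -> nat) (f : X -> A) (x : X) : seq A :=
  map f (traject T x (r x).+1).

Lemma itinerary_refines_time A (r : X -> nat) (f : X -> A) :
  refines (itinerary r f) r.
Proof.
move=> x y /(congr1 size).
by rewrite /itinerary !size_map !size_traject => -[].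
Qed.

Lemma itinerary_refines A (r : X -> nat) (f : X -> A) :
  refines (itinerary r f) f.
Proof. by move=> x y []. Qed.

(** The itinerary of [T x] is that of [x] without its first entry.  This is
    where ending the itinerary at [r] matters: an itinerary of fixed length
    would need one more entry after the step, and the cell of [x] would not
    determine that of [T x]. *)
Lemma itinerary_step A (r : X -> nat) (f : X -> A) x y :
  (forall z, (0 < r z)%N -> r z = (r (T z)).+1) ->
  (0 < r x)%N -> itinerary r f x = itinerary r f y ->
  itinerary r f (T x) = itinerary r f (T y).
Proof.
move=> rT rx_gt0 exy; have rxy := itinerary_refines_time exy.
move: exy; rewrite /itinerary (rT x)// (rT y); last by rewrite -rxy.
exact: (congr1 behead).
Qed.

Lemma locally_constant_traject A (f : X -> A) n :
  continuous T -> locally_constant f ->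
  locally_constant (fun x => map f (traject T x n)).
Proof.
move=> cT lf; elim: n => [|n IH] x; first exact: nearW.
have := locally_constant_pair lf (locally_constant_precomp cT IH).
by move=> /(_ x); apply: filterS => y /= [-> ->].
Qed.

Lemma locally_constant_itinerary A (r : X -> nat) (f : X -> A) :
  continuous T -> locally_constant r -> locally_constant f ->
  locally_constant (itinerary r f).
Proof.
move=> cT lr lf x.
apply: filterS2 (lr x) (locally_constant_traject (r x).+1 cT lf x) => y rxy.
by rewrite /itinerary rxy.
Qed.

End itinerary.

Section hitting_time.
Context {X : topologicalType} (T : X -> X) (u : X -> bool).
Context (hit : forall x, exists n, u (iter n T x)).

Definition hitting_time (x : X) : nat := ex_minn (hit x).

Lemma hitting_time_gt0 x : (0 < hitting_time x)%N = ~~ u x.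
Proof.
rewrite /hitting_time; case: ex_minnP => -[|n] /= un minn; first by rewrite un.
by apply/esym/negP => /(minn 0%N).
Qed.

Lemma hitting_time_step x :
  (0 < hitting_time x)%N -> hitting_time x = (hitting_time (T x)).+1.
Proof.
rewrite /hitting_time; case: ex_minnP => -[//|n]; rewrite iterSr => un minn _.
case: ex_minnP => m um minm; congr S; apply/eqP.
by rewrite eqn_leq minm// andbT -ltnS; apply: minn; rewrite iterSr.
Qed.

Lemma locally_constant_hitting_time :
  continuous T -> locally_constant u -> locally_constant hitting_time.
Proof.
move=> cT lu x; have := locally_constant_traject (hitting_time x).+1 cT lu x.
apply: filterS => y eyx.
have ueq j : (j <= hitting_time x)%N -> u (iter j T y) = u (iter j T x).
  move=> jx; have : nth false (map u (traject T y (hitting_time x).+1)) j =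
                    nth false (map u (traject T x (hitting_time x).+1)) j.
    by rewrite eyx.
  by rewrite (nth_map y) ?size_traject// (nth_map x) ?size_traject// !nth_traject.
move: ueq; rewrite /hitting_time.
case: ex_minnP => m um minm; case: ex_minnP => k uk mink ueq.
have km : (k <= m)%N by apply: mink; rewrite ueq.
by apply/eqP; rewrite eqn_leq km minm// -ueq.
Qed.

End hitting_time.

(** * Partitions of a Cantor set *)

Section cantor.
Context {R : realType} {C : metricType R}.

(** Locally constant functions are directed by refinement.  A clopen
    neighbourhood of [x] inside a ball settles the claim near [x] for all the
    functions that refine its indicator, and compactness, used along this
    directed family, gives one function that works everywhere. *)
Lemma fine_locally_constant (e : R) :
    hausdorff_space C -> zero_dimensional C -> compact [set: C] -> 0 < e ->
  exists2 g : C -> nat, locally_constant g &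
    forall x y, g x = g y -> ball x e y.
Proof.
move=> hC zC cC e0.
pose F := filter_from [set g : C -> nat | locally_constant g]
                      (fun g => [set h : C -> nat | refines h g]).
have FF : Filter F.
  apply: filter_from_filter; first by exists (fun=> 0%N) => x; exact: nearW.
  move=> g h lg lh; exists (fun x => pickle (g x, h x)).
    apply: locally_constant_refines (locally_constant_pair lg lh).
    by move=> x y ->.
  move=> k kgh; split=> x y /kgh /(pcan_inj pickleK) [] //.
move: (cC) => /compact_near_coveringP/(_ _ F
  (fun g x => forall y, g x = g y -> ball x e y) FF) [].
  move=> x _; have e2 : 0 < e / 2 by rewrite divr_gt0.
  have [D [Dx cD] DB] := zero_dimensional_cvg hC zC cC (nbhsx_ballx x _ e2).
  exists (D, [set h | refines h (fun y => nat_of_bool `[< D y >])]).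
    split; first by apply: open_nbhs_nbhs; split => //; case: cD.
    exists (fun y => nat_of_bool `[< D y >]) => //.
    apply: locally_constant_refines (locally_constant_clopen cD).
    by move=> y z ->.
  move=> -[x' h] [/= Dx' hD] y /hD; rewrite asboolT// => /esym/eqP.
  rewrite eqb1 => /asboolP Dy.
  by apply: (@ball_splitr _ _ x); exact: DB.
by move=> g lg /(_ g) H; exists g => // x y; apply: H.
Qed.

(** Since [x0] is not isolated, there are clopen sets in any ball around [x0]
    that do not contain it.  Those in balls shrinking to [x0] eventually avoid
    every point, including [x0]. *)
Lemma vanishing_clopen :
    [set: C] !=set0 -> cantor_like C ->
  exists u : nat -> C -> bool, [/\ forall n, locally_constant (u n),
    forall n, exists z, u n z &
    forall x, \forall n \near \oo, ~~ u n x].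
Proof.
move=> [x0 _] [[_ pC] cC hC zC].
have /choice[u hu] (n : nat) : exists v : C -> bool, [/\ locally_constant v,
    exists z, v z & forall x, v x -> ball x0 n.+1%:R^-1 x /\ x != x0].
  set B := ball x0 _.
  have Bx0 : nbhs x0 B by apply: nbhsx_ballx; rewrite invr_gt0.
  have : limit_point [set: C] x0 by rewrite pC.
  move=> /(_ B° (nbhs_interior Bx0)) [z [zx0 _ Bz]].
  have oV : nbhs z (B `&` [set~ x0]).
    apply: filterI => //; apply: open_nbhs_nbhs; split; last exact/eqP.
    apply: closed_openC; apply: accessible_closed_set1.
    exact: hausdorff_accessible.
  have [D [Dz cD] DV] := zero_dimensional_cvg hC zC cC oV.
  exists (fun x => `[< D x >]); split; first exact: locally_constant_clopen.
    by exists z; apply/asboolP.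
  by move=> x /asboolP/DV [Bx /eqP].
exists u; split=> [n|n|x]; [by case: (hu n)|by case: (hu n)|].
have [->|xx0] := eqVneq x x0.
  apply: nearW => n; apply/negP; case: (hu n) => _ _ /[apply].
  by rewrite eqxx => -[].
have : nbhs x0 [set~ x].
  apply: open_nbhs_nbhs; split; last by apply/eqP; rewrite eq_sym.
  apply: closed_openC; apply: accessible_closed_set1.
  exact: hausdorff_accessible.
move=> /nbhs_ballP [e /= e0 eB]; near=> n; apply/negP.
case: (hu n) => _ _ /[apply] -[Bx _].
apply: (eB x) => //; apply: le_ball Bx; apply/ltW.
by near: n; exact: near_infty_natSinv_lt (PosNum e0).
Unshelve. all: by end_near. Qed.

End cantor.

(** [p n] labels the cells of the partition of level [n] and [r n] is the
    height of a cell, which is [0] on the exceptional set of that level.  The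
    fields [code_step] and [height_step] say that above height [0] the cells
    of level [n] descend by one step under [T]; by [height_gt0], for each
    point this holds at all but finitely many levels. *)
Record contracting_codes {R : realType} {C : metricType R} (T : C -> C)
    (p r : nat -> C -> nat) : Prop := {
  code_locally_constant : forall n, locally_constant (p n) ;
  code_init : forall x y, p 0%N x = p 0%N y ;
  code_refines : forall n, refines (p n.+1) (p n) ;
  code_height : forall n, refines (p n) (r n) ;
  code_step : forall n x y, (0 < r n x)%N -> p n x = p n y ->
    p n (T x) = p n (T y) ;
  height_step : forall n x, (0 < r n x)%N -> r n x = (r n (T x)).+1 ;
  height_gt0 : forall x, \forall n \near \oo, (0 < r n x)%N ;
  code_fine : forall n x y, p n.+1 x = p n.+1 y -> ball x n.+1%:R^-1 y }.

Lemma exists_contracting_codes (R : realType) (C : metricType R) (T : C -> C) :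
  cantor_system T -> minimal T -> exists p r, contracting_codes T p r.
Proof.
move=> [[C0 Ccantor] cT] minT; case: (Ccantor) => _ cC hC zC.
have [u [lu u0 uoo]] := vanishing_clopen C0 Ccantor.
have hit n x : exists k, u n (iter k T x).
  have [z uz] := u0 n.
  have [|y [uy [k _ ky]]] :=
    minT x [set x | u n x] _ (open_locally_constant_fiber (lu n)).
    by exists z.
  by exists k; rewrite ky.
pose r n := hitting_time (hit n).
have /choice[g hg] (n : nat) : exists h : C -> nat, locally_constant h /\
    forall x y, h x = h y -> ball x n.+1%:R^-1 y.
  have [|g lg gB] := @fine_locally_constant R C n.+1%:R^-1 hC zC cC.
    by rewrite invr_gt0.
  by exists g.
pose itin n (f : C -> nat) := itinerary T (r n) (fun z => (f z, g n z)).
(* The label of level [n.+1] also records that of level [n], which makes the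
   partitions nested, and a label of the fine partition [g n]. *)
pose p := fix p n : C -> nat :=
  if n is m.+1 then fun x => pickle (itin m (p m) x) else fun=> 0%N.
have pI n : refines (p n.+1) (itin n (p n)) by move=> x y /(pcan_inj pickleK).
have Ip n : refines (itin n (p n)) (p n.+1) by move=> x y exy; congr pickle.
(* Level [0] is the trivial partition, hence the shift of the heights. *)
exists p, (fun n => if n is m.+1 then r m else fun=> 0%N); split=> //.
- elim=> [|n IH]; first by move=> x; exact: nearW.
  apply: locally_constant_refines (Ip n) _.
  apply: locally_constant_itinerary => //.
    exact: locally_constant_hitting_time.
  by apply: locally_constant_pair => //; case: (hg n).
- by move=> n x y /pI /itinerary_refines [].
- by case=> [//|n] x y /pI /itinerary_refines_time.
- case=> [//|n] x y rx /pI exy; apply: Ip.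
  by apply: itinerary_step rx exy => z; exact: hitting_time_step.
- by case=> [//|n] x; exact: hitting_time_step.
- move=> x; have [m _ um] := uoo x; exists m.+1 => // -[//|n] /= mn.
  by rewrite /r hitting_time_gt0; exact: um.
- move=> n x y /pI /itinerary_refines [_].
  by case: (hg n) => _; apply.
Qed.

(** * Position on the line *)

Section position.
Context {R : realType} {C : metricType R} (T : C -> C) (p r : nat -> C -> nat).
Context (pr : contracting_codes T p r) (N M : nat -> nat).
Context (pN : forall n x, (p n.+1 x <= N n)%N).
Context (rM : forall n x, (r n x <= M n)%N).

(** The widths are multiplied by this at each unit of height.  The factor
    [(N n).+1] makes the diameter of a cell, at most [(N n).+1] widths, fit in
    one width of the next height; [n.+1] is the gain in the slope. *)
Let ratio n : R := (n.+1 * (N n).+1)%:R.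

(** The smallest width of level [n].  All the digits of level [n.+1] weigh at
    most [scale n / 4], so that the whole tail after level [n] is at most
    [scale n / 2] and cannot close a gap of level [n]. *)
Fixpoint scale n : R :=
  if n is m.+1 then scale m / (4 * (ratio n ^+ M n * (N n).+1%:R)) else 1.

Let width n x := scale n * ratio n ^+ r n x.

Let partial n x := \sum_(k < n) width k x * (p k.+1 x)%:R.

Definition position x := sup (range (partial ^~ x)).

Let ratio_ge1 n : 1 <= ratio n.
Proof. by rewrite /ratio ler1n muln_gt0. Qed.

Lemma scale_gt0 n : 0 < scale n.
Proof.
by elim: n => [|n IH] //=; rewrite divr_gt0// !mulr_gt0// exprn_gt0.
Qed.

Let scale_le_width n x : scale n <= width n x.
Proof. by rewrite /width ler_peMr ?exprn_ege1 ?(ltW (scale_gt0 n)). Qed.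

Let width_gt0 n x : 0 < width n x.
Proof. exact: lt_le_trans (scale_gt0 n) (scale_le_width n x). Qed.

Let width_succ n x : width n.+1 x * (N n.+1).+1%:R <= scale n / 4.
Proof.
have /ltW r0 := lt_le_trans ltr01 (ratio_ge1 n.+1).
have N0 : 0 < (N n.+1).+1%:R :> R by [].
have q0 : 0 < ratio n.+1 ^+ M n.+1.
  by rewrite exprn_gt0// (lt_le_trans ltr01 (ratio_ge1 _)).
have : ratio n.+1 ^+ r n.+1 x <= ratio n.+1 ^+ M n.+1
  by rewrite ler_weXn2l.
rewrite /width /=; set a := _ ^+ r _ x; set b := _ ^+ M _ in q0 *.
move: (scale_gt0 n); move: (scale n) => s s0 ab.
rewrite (_ : _ * a * _ = (s / 4) * (a / b)); last first.
  by field; rewrite ?gt_eqF.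
by rewrite ler_piMr//; [rewrite divr_ge0// ltW|rewrite ler_pdivrMr// mul1r].
Qed.

Let scale_succ n : scale n.+1 <= scale n / 4.
Proof.
have q1 : 1 <= ratio n.+1 ^+ M n.+1 * (N n.+1).+1%:R.
  by rewrite mulr_ege1 ?exprn_ege1// ler1n.
have q0 := lt_le_trans ltr01 q1.
rewrite /= ler_pdivrMr; last by rewrite mulr_gt0.
by rewrite [leRHS]mulrA divfK// ler_peMr// (ltW (scale_gt0 n)).
Qed.

Lemma scale_le n : scale n <= n.+1%:R^-1.
Proof.
elim: n => [|n IH]; first by rewrite invr1.
apply: le_trans (scale_succ n) _; apply: le_trans (_ : n.+1%:R^-1 / 4 <= _).
  by rewrite ler_pM2r.
rewrite -invfM lef_pV2 ?posrE ?mulr_gt0// -natrM ler_nat.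
by rewrite mulSn -addn2 addnC leq_add// leq_pmulr.
Qed.

Let partialS n x : partial n.+1 x = partial n x + width n x * (p n.+1 x)%:R.
Proof. by rewrite /partial big_ord_recr. Qed.

Let partial_bounds n m x : (n <= m)%N ->
  partial n.+1 x <= partial m.+1 x /\
  partial m.+1 x + scale m / 2 <= partial n.+1 x + scale n / 2.
Proof.
move=> /subnK <-; elim: (m - n)%N => [//|k [IH1 IH2]]; rewrite addSn.
set j := (k + n)%N in IH1 IH2 *; rewrite (partialS j.+1).
have d0 : 0 <= width j.+1 x * (p j.+2 x)%:R
  by rewrite mulr_ge0 ?(ltW (width_gt0 _ _)).
have : width j.+1 x * (p j.+2 x)%:R <= scale j / 4.
  apply: le_trans (width_succ j x); rewrite ler_pM2l// ler_nat.
  exact: leq_trans (pN _ _) _.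
have := scale_succ j; have := scale_gt0 j.
by move: d0; set d := _ * _; split; lra.
Qed.

Let position_bounds n x :
  partial n.+1 x <= position x <= partial n.+1 x + scale n / 2.
Proof.
have ub k : partial k x <= partial n.+1 x + scale n / 2.
  have := scale_gt0 (maxn n k).
  have [_] := partial_bounds x (leq_maxl n k).
  have [+ _] := partial_bounds x (leq_maxr n k).
  have := partialS k x.
  have : 0 <= width k x * (p k.+1 x)%:R
    by rewrite mulr_ge0 ?(ltW (width_gt0 _ _)).
  lra.
apply/andP; split.
  apply: ub_le_sup; last by exists n.+1.
  by exists (partial n.+1 x + scale n / 2) => _ [k _ <-].
apply: ge_sup; first by exists (partial 0%N x); exists 0%N.
by move=> _ [k _ <-].
Qed.

Let code_refines_le m n : (m <= n)%N -> refines (p n) (p m).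
Proof.
move=> /subnK <-; elim: (n - m)%N => [//|k IH]; rewrite addSn.
by move=> x y /(code_refines pr) /IH.
Qed.

Let width_refines n : refines (p n) (width n).
Proof. by move=> x y /(code_height pr); rewrite /width => ->. Qed.

Let partial_refines n : refines (p n) (partial n).
Proof.
move=> x y exy; apply: eq_bigr => k _.
by rewrite (width_refines (code_refines_le (ltnW (ltn_ord k)) exy))
           (code_refines_le (ltn_ord k) exy).
Qed.

Lemma position_close n x y :
  p n.+1 x = p n.+1 y -> `|position x - position y| <= scale n / 2.
Proof.
move=> /partial_refines exy.
have := position_bounds n x; have := position_bounds n y; rewrite exy ler_distl.
lra.
Qed.

Lemma position_dist_le n x y :
  p n x = p n y -> `|position x - position y| <= width n x * (N n).+1%:R.
Proof.
move=> exy; have := position_bounds n x; have := position_bounds n y.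
rewrite !partialS (partial_refines exy) (width_refines exy) ler_distl.
have := scale_le_width n y; have := scale_gt0 n.
have w0 := ltW (width_gt0 n y).
have term_bounds z : 0 <= width n y * (p n.+1 z)%:R <= width n y * (N n)%:R.
  by rewrite mulr_ge0// ler_wpM2l// ler_nat.
rewrite -[(N n).+1%:R]natr1 mulrDr mulr1.
move: (term_bounds x) (term_bounds y); lra.
Qed.

(** The two digits of level [n] differ by at least one width, of which the
    tails can take back at most half. *)
Lemma position_dist_ge n x y : p n x = p n y -> p n.+1 x <> p n.+1 y ->
  width n x / 2 <= `|position x - position y|.
Proof.
wlog pxy : x y / (p n.+1 x <= p n.+1 y)%N => [H exy nxy|].
  have [|/ltnW yx] := leqP (p n.+1 x) (p n.+1 y); first by move=> /H; apply.
  rewrite distrC (width_refines exy); apply: H => //.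
  by move=> /esym.
move=> exy nxy; rewrite distrC.
have {nxy pxy} : (p n.+1 x)%:R + 1 <= (p n.+1 y)%:R :> R.
  by rewrite natr1 ler_nat ltn_neqAle pxy andbT; exact/eqP.
have := position_bounds n x; have := position_bounds n y.
rewrite !partialS (partial_refines exy) (width_refines exy).
have := scale_le_width n y; have := scale_gt0 n; have w0 := width_gt0 n y.
move=> s0 sw bx b_y pp; apply: le_trans (ler_norm _).
nra.
Qed.

(** The levels are gone through in order, because the lower bound at level [n]
    requires that the points have not been separated before. *)
Lemma code_of_position n x y :
  `|position x - position y| < scale n / 2 -> p n.+1 x = p n.+1 y.
Proof.
elim: n => [|n IH] dxy.
  have e0 := code_init pr x y.
  apply: contrapT => /(position_dist_ge e0).
  have := scale_le_width 0 x; move: dxy; lra.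
have e0 : p n.+1 x = p n.+1 y.
  apply: IH; have := scale_succ n; have := scale_gt0 n; move: dxy; lra.
apply: contrapT => /(position_dist_ge e0).
have := scale_le_width n.+1 x; move: dxy; lra.
Qed.

(** One step of [T] divides the width by the ratio, which beats the number of
    digits by the factor [n.+1]. *)
Lemma position_contract n x y : p n x = p n y -> p n.+1 x <> p n.+1 y ->
  (0 < r n x)%N ->
  `|position (T x) - position (T y)| <=
    2 / n.+1%:R * `|position x - position y|.
Proof.
move=> exy nxy rx.
have := position_dist_le (code_step pr rx exy).
have := position_dist_ge exy nxy.
rewrite {1}/width (height_step pr rx) exprS mulrCA -/(width n (T x)).
rewrite /ratio natrM; set w := width _ _; set d := `|_|; set d' := `|_|.
have n0 : 0 < n.+1%:R :> R by [].
move=> far near; rewrite mulrAC ler_pdivlMr//; nra.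
Qed.

Let scale_lt (e : R) : 0 < e -> exists n, scale n < e.
Proof.
move=> e0; have [n _ /(_ n (leqnn n)) /= ne] := near_infty_natSinv_lt (PosNum e0).
by exists n; exact: le_lt_trans (scale_le n) ne.
Qed.

Lemma position_continuous : continuous position.
Proof.
move=> x; apply/cvgrPdist_lt => e /scale_lt [n ne].
apply: filterS (code_locally_constant pr n.+1 x) => y /esym /position_close.
by have := scale_gt0 n; lra.
Qed.

Lemma position_ball x (e : R) : 0 < e ->
  exists2 d, 0 < d & forall y, `|position x - position y| < d -> ball x e y.
Proof.
move=> e0; have [n _ /(_ n (leqnn n)) /= ne] := near_infty_natSinv_lt (PosNum e0).
exists (scale n / 2); first by rewrite divr_gt0// scale_gt0.
move=> y /code_of_position /(code_fine pr); apply: le_ball; exact: ltW.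
Qed.

Lemma position_inj : hausdorff_space C -> injective position.
Proof.
move=> hC x y exy; apply: (close_eq hC); rewrite ball_close => e.
have [|d d0] := @position_ball x e%:num; first by [].
by apply; rewrite exy subrr normr0.
Qed.

(** If [y] is close to [x], the level at which they are first separated is
    large, so that it is a level at which [x] is not exceptional. *)
Lemma position_slope x (e : R) : hausdorff_space C -> 0 < e ->
  exists2 d, 0 < d & forall y, `|position x - position y| < d ->
    `|position (T x) - position (T y)| <= e * `|position x - position y|.
Proof.
move=> hC e0; have [n0 _ rn0] := height_gt0 pr x.
have e2 : 0 < e / 2 by rewrite divr_gt0.
have [n1 _ en1] := near_infty_natSinv_lt (PosNum e2).
pose n := maxn n0 n1; exists (scale n / 2); first by rewrite divr_gt0// scale_gt0.
move=> y /code_of_position pnxy.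
have [->|/eqP nxy] := eqVneq x y; first by rewrite !subrr normr0 mulr0.
have exm : exists m, p m x != p m y.
  apply: contrapT => /forallNP same; apply: nxy; apply: (close_eq hC).
  rewrite ball_close => d.
  have [k _ /(_ k (leqnn k)) /= kd] := near_infty_natSinv_lt d.
  apply: le_ball (ltW kd) _ _; apply: (code_fine pr).
  by apply/eqP; move/negP: (same k.+1); rewrite negbK.
have [[|k] pk mink] := ex_minnP exm.
  by rewrite (code_init pr x y) eqxx in pk.
have nk : (n < k)%N.
  rewrite ltnNge; apply/negP => kn; move/eqP: pk; apply.
  by apply: (@code_refines_le k.+1 n.+1).
have ek : p k x = p k y.
  by apply/eqP; apply/negPn/negP => /mink; rewrite ltnn.
apply: le_trans (position_contract ek _ _) _; first exact/eqP.
  by apply: rn0 => /=; apply: leq_trans (ltnW nk); exact: leq_maxl.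
apply: ler_wpM2r => //; rewrite mulrC -ler_pdivlMr//; apply: ltW.
by apply: en1 => /=; apply: leq_trans (ltnW nk); exact: leq_maxr.
Qed.

End position.

(** * The embedding *)

Theorem theorem1p2 (R : realType) (C : metricType R) (T : C -> C)
    (hCT : cantor_system T) (hmin : minimal T) :
  exists (pi : C -> R) (piV : R -> C),
    embedding_with_inverse pi piV /\
    forall x : R, range pi x ->
      has_derivative_within (range pi) (pi \o T \o piV) x 0.
Proof.
have [p [r pr]] := exists_contracting_codes hCT hmin.
move: hCT => [[[x0 _] [_ cC hC _]] _].
have /choice[N pN] n :=
  locally_constant_bounded cC (code_locally_constant pr n.+1).
have /choice[M rM] n := locally_constant_bounded cC
  (locally_constant_refines (code_height pr (n := n)) (code_locally_constant pr n)).
pose pi := position p r N M.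
have pi_inj : injective pi := position_inj pr pN rM hC.
pose piV z := xget x0 [set c | pi c = z].
have piK : cancel pi piV.
  move=> c; apply: pi_inj; rewrite /piV.
  by case: xgetP => [y _ -> //|/(_ c) /(_ erefl)].
exists pi, piV; split.
  have cpi : continuous pi := position_continuous pr pN rM.
  split=> //.
  apply/subspace_continuousP => _ [x _ <-]; rewrite /from_subspace piK.
  apply/cvg_ballP => e e0.
  have [d d0 dB] := position_ball pr pN rM x e0.
  rewrite near_withinE; apply/nbhs_ballP.
  exists d => //= z dz [y _ yz].
  by move: dz; rewrite -yz piK; exact: dB.
move=> _ [x _ <-]; apply/cvgrPdist_lt => e e0.
have e2 : 0 < e / 2 by rewrite divr_gt0.
have [d d0 dS] := position_slope pr pN rM x hC e2.
rewrite near_withinE near_withinE; apply/nbhs_ballP.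
exists d => //= z dz zx [y _ yz].
rewrite -yz /= !piK sub0r normrN normrM normfV.
have /dS H : `|pi x - pi y| < d by rewrite yz.
have nz : 0 < `|pi y - pi x| by rewrite normr_gt0 subr_eq0 yz.
rewrite ltr_pdivrMr// distrC; apply: le_lt_trans H _.
by rewrite distrC ltr_pM2r//; lra.
Qed.
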